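(* Let $p\in\mathbb{Z}^n$ have all components positive, let $r\in\mathbb{Z}^n$, suppose that $p$ is not a multiple of $r$ and that $r_1/p_1\le\dots\le r_n/p_n$. Let $k$ and $M$ be integers with $$k\ge 0,\qquad M>\max\{\,k r_n/p_n - k r_1/p_1 - r_1/p_1 + 1,\; 2\sqrt n\,\|r\|^2\|p\|^2\,\}.$$ Then there exists an integer $\beta$ such that $$k(M+r_n/p_n)<\beta<(k+1)(M+r_1/p_1),$$ and for all such $\beta$ the problem $$\text{(KP-EQ)}\qquad ax=\beta,\quad x\ge 0,\quad x\in\mathbb{Z}^n$$ with $a=pM+r$ has the following properties: 1. Its infeasibility is proven by $px\le k\,\vee\,px\ge k+1$. 2. Ordinary branch-and-bound needs at least $$\binom{\lfloor k/\|p\|_\infty\rfloor+n-1}{n-1}$$ nodes to prove its infeasibility, independently of the sequence in which the branching variables are chosen. 3. The infeasibility of the AHL reformulation computed with KZ-reduction is proven at the root node by branching on the last variable, i.e. $\lambda_{n-1}$ is nonintegral for every $\lambda$ in the LP relaxation of the AHL reformulation.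
   Context: $\|\cdot\|$ is the Euclidean norm; $px$, $ax$ denote inner products. The LP relaxation of an integer program is obtained by dropping integrality. Split disjunction: the infeasibility of an integer program is proven by $px \le k \vee px \ge k+1$ if both $\{x : px \le k\}$ and $\{x : px \ge k+1\}$ have empty intersection with the feasible set of its LP relaxation. Ordinary branch-and-bound means branch-and-bound branching on individual variables. A node is identified by a node-fixing $(\bar x,F)$: a set $F\subseteq \{1,\dots,n\}$ of fixed variables and nonnegative integers $\bar x_i$ $(i\in F)$. Variables are chosen for branching in some order $x_{j_1},\dots,x_{j_n}$; the root has $F=\emptyset$; a node with $F=\{j_1,\dots,j_t\}$, $t<n$, generates one node for each integer value that $x_{j_{t+1}}$ can take such that the LP relaxation with the resulting fixings is feasible. A node is pruned only when its LP relaxation is infeasible (such nodes are not counted). The number of nodes is the total number of nodes so generated. AHL reformulation of (KP-EQ): let $V\in\mathbb{Z}^{n\times(n-1)}$ be a matrix whose columns are a reduced basis (here: KZ-reduced) of $\{v\in\mathbb{Z}^n: av=0\}$, and let $x_\beta\in\mathbb{Z}^n$ be any vector with $ax_\beta=\beta$ (the reformulation is defined when such a vector exists). The reformulation is: $V\lambda+x_\beta\ge 0$, $\lambda\in\mathbb{Z}^{n-1}$. KZ-reduction (Korkhine–Zolotarev): for linearly independent $b_1,\dots,b_s$ with Gram–Schmidt vectors $b_1^*,\dots,b_s^*$, write $b_i=\sum_{j\le i}\mu_{ij}b_j^*$ with $\mu_{ii}=1$, put $b_i(k)=\sum_{j=k}^i\mu_{ij}b_j^*$ for $1\le k\le i$,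 and let $L_i$ be the lattice generated by $b_i(i),b_{i+1}(i),\dots,b_s(i)$. The basis is KZ-reduced if $b_i(i)$ is a shortest nonzero vector of $L_i$ for all $i$, and $|\mu_{ij}|\le 1/2$ for $1\le j<i\le s$. *)

(* Defs.v *)
From mathcomp Require Import all_boot all_order all_algebra.
From mathcomp Require Import perm.
From mathcomp Require Import boolp classical_sets cardinality reals.

Set Implicit Arguments.
Unset Strict Implicit.
Unset Printing Implicit Defensive.

Import Order.TTheory GRing.Theory Num.Theory.

Local Open Scope ring_scope.

(* All vectors, including p, r and a, are column vectors. *)
Definition dot (S : comNzRingType) (n : nat) (u v : 'cV[S]_n) : S :=
  \sum_(i < n) u i 0 * v i 0.

Definition enorm (R : realType) (n : nat) (u : 'cV[R]_n) : R :=
  Num.sqrt (dot u u).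

Definition normoo (n : nat) (p : 'cV[int]_n) : nat :=
  \max_(i < n) `|p i 0%R|%N.

Definition mx_of_int (R : realType) (m n : nat) (A : 'M[int]_(m, n)) :
  'M[R]_(m, n) := map_mx intr A.

Definition KPEQ_relaxation (R : realType) (n : nat) (a : 'cV[int]_n)
    (beta : int) : set 'cV[R]_n :=
  [set x | dot (mx_of_int R a) x = beta%:~R /\ forall i : 'I_n, 0 <= x i 0].

Arguments KPEQ_relaxation R {n} a beta.

Definition proven_by_split (R : realType) (n : nat) (P : set 'cV[R]_n)
    (p : 'cV[int]_n) (k : int) : Prop :=
  (P `&` [set x | dot (mx_of_int R p) x <= k%:~R] = set0)%classic /\
  (P `&` [set x | (k + 1)%:~R <= dot (mx_of_int R p) x] = set0)%classic.

(* A node-fixing (xbar, F) is the partial function with domain F and values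
   xbar: f i = Some v when i is in F and xbar_i = v, f i = None otherwise. *)
Definition node_fixing (n : nat) : Type := {ffun 'I_n -> option nat}.

Definition root_fixing (n : nat) : node_fixing n := [ffun => None].

Definition fix_var (n : nat) (f : node_fixing n) (j : 'I_n) (v : nat) :
    node_fixing n :=
  [ffun i => if i == j then Some v else f i].

Definition node_relaxation (R : realType) (n : nat) (P : set 'cV[R]_n)
    (f : node_fixing n) : set 'cV[R]_n :=
  [set x | P x /\ forall (i : 'I_n) (v : nat), f i = Some v -> x i 0 = v%:R].

(* bb_node P s t f: f is an unpruned node of depth t, the variables being
   branched on in the order s 0, s 1, ..., s (n - 1). *)
Inductive bb_node (R : realType) (n : nat) (P : set 'cV[R]_n) (s : 'S_n) :
    nat -> node_fixing n -> Prop :=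
| bb_root :
    (node_relaxation P (root_fixing n) !=set0)%classic ->
    bb_node P s 0 (root_fixing n)
| bb_child (t : 'I_n) (f : node_fixing n) (v : nat) :
    bb_node P s t f ->
    (node_relaxation P (fix_var f (s t) v) !=set0)%classic ->
    bb_node P s t.+1 (fix_var f (s t) v).

(* The root is counted.  Distinct nodes of the tree have distinct fixings. *)
Definition bb_nodes (R : realType) (n : nat) (P : set 'cV[R]_n) (s : 'S_n) :
    set (node_fixing n) :=
  [set f | exists t : nat, bb_node P s t f].

Section KZ.
Variables (R : realType) (n s : nat) (B : 'M[R]_(n, s)).

(* The first argument is fuel; i.+1 is enough to reach the i-th vector, see
   gram_schmidtE. *)
Fixpoint gram_schmidt_rec (fuel : nat) (i : 'I_s) : 'cV[R]_n :=
  if fuel is fuel'.+1 then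
    col i B - \sum_(j < s | (j < i)%N)
      let bj := gram_schmidt_rec fuel' j in
      (dot (col i B) bj / dot bj bj) *: bj
  else 0.

Definition gram_schmidt (i : 'I_s) : 'cV[R]_n := gram_schmidt_rec i.+1 i.

Definition gs_mu (i j : 'I_s) : R :=
  if j == i then 1
  else dot (col i B) (gram_schmidt j) /
       dot (gram_schmidt j) (gram_schmidt j).

Lemma gram_schmidtE (i : 'I_s) :
  gram_schmidt i =
  col i B - \sum_(j < s | (j < i)%N) gs_mu i j *: gram_schmidt j.
Proof.
have fuelE (f g : nat) : forall i : 'I_s, (i < f)%N -> (i < g)%N ->
    gram_schmidt_rec f i = gram_schmidt_rec g i.
  elim: f g => [//|f IHf] [//|g] l lf lg /=; congr (_ - _).
  apply: eq_bigr => j jl.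
  by rewrite (IHf g j (leq_trans jl lf) (leq_trans jl lg)).
rewrite {1}/gram_schmidt /=; congr (_ - _); apply: eq_bigr => j ji.
by rewrite /gs_mu -val_eqE (ltn_eqF ji) (fuelE i j.+1 j ji).
Qed.

(* b_i(k), the component of b_i orthogonal to b_1, ..., b_(k-1). *)
Definition gs_proj (k i : 'I_s) : 'cV[R]_n :=
  \sum_(j < s | (k <= j <= i)%N) gs_mu i j *: gram_schmidt j.

(* The lattice L_i generated by b_i(i), ..., b_s(i). *)
Definition gs_lattice (i : 'I_s) : set 'cV[R]_n :=
  [set v | exists z : 'I_s -> int,
     v = \sum_(j < s | (i <= j)%N) (z j)%:~R *: gs_proj i j].

Definition shortest_nonzero (L : set 'cV[R]_n) (u : 'cV[R]_n) : Prop :=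
  [/\ L u, u <> 0 & forall v, L v -> v <> 0 -> enorm u <= enorm v].

Definition KZ_reduced : Prop :=
  [/\ \rank B = s,
      forall i : 'I_s, shortest_nonzero (gs_lattice i) (gs_proj i i) &
      forall i j : 'I_s, (j < i)%N -> `|gs_mu i j| <= 1 / 2].

End KZ.

Definition null_lattice_basis (n s : nat) (a : 'cV[int]_n)
    (V : 'M[int]_(n, s)) : Prop :=
  (forall v : 'cV[int]_n, dot a v = 0 <-> exists z : 'cV[int]_s, v = V *m z) /\
  (forall z : 'cV[int]_s, V *m z = 0 -> z = 0).

Definition AHL_relaxation (R : realType) (n s : nat) (V : 'M[int]_(n, s))
    (xbeta : 'cV[int]_n) : set 'cV[R]_s :=
  [set lam | forall i : 'I_n, 0 <= (mx_of_int R V *m lam + mx_of_int R xbeta) i 0].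

Arguments AHL_relaxation R {n s} V xbeta.

(* The last variable is the one with index i such that i + 1 = s. *)
Definition proven_by_last_variable (R : realType) (s : nat)
    (Q : set 'cV[R]_s) : Prop :=
  forall lam : 'cV[R]_s, Q lam ->
  forall i : 'I_s, i.+1 = s -> lam i 0 \isn't a Num.int.

(* Main.v *)
Require Import Defs.
From mathcomp Require Import all_boot all_order all_algebra.
From mathcomp Require Import perm.
From mathcomp Require Import boolp classical_sets cardinality reals.
From mathcomp Require Import ring lra.

Set Implicit Arguments.
Unset Strict Implicit.
Unset Printing Implicit Defensive.

Import Order.TTheory GRing.Theory Num.Theory.

Local Open Scope ring_scope.

(** Write c = M + r_1/p_1 and C = M + r_n/p_n, where 0 < c <= C.  Since the
    ratios a_i/p_i lie in [c, C], every x >= 0 satisfies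
    c (px) <= ax <= C (px).  Hence ax = beta with k C < beta < (k+1) c forces
    k < px < k+1, which is the split disjunction ([split_of_ratio_bounds]); the
    lower bound on M makes (k C, (k+1) c) longer than 1, so that beta exists.

    Branch-and-bound: assigning nonnegative integers with p-weight at most k to
    any m of the m+1 variables uses at most C k < beta of the right-hand side,
    and the remaining variable absorbs the rest, so this partial assignment is
    an unpruned node.  An assignment with sum at most k / |p|_oo has p-weight at
    most k, and these assignments are counted by the binomial coefficient
    ([card_le_bb_nodes]).

    Reformulation: it suffices that p is orthogonal to all columns of V but the
    last ([KZ_basis_orthogonal]).  Then px = (integer) + (integer) lambda_last
    on the relaxation, while px lies strictly between k and k+1, so
    lambda_last is not an integer ([last_variable_of_split]).
    For the orthogonality, let b_i be the first column with p b_i <> 0, and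
    suppose that it is not the last one.  From a b_i = 0 one gets
    |r b_i| = M |p b_i| >= M, and passing to the Gram-Schmidt vector b_i^*
    changes neither p b_i nor r b_i, so |b_i^*| >= M / |r|.  On the other hand,
    b_i^* is shortest among the nonzero projections of lattice vectors
    orthogonally to b_1, ..., b_(i-1).  The lattice contains the integral
    vectors [cross p r a b l], which are supported on three coordinates, are
    orthogonal to p and r, and have norm at most |p| |r|.  As they
    span a space of codimension 2, at least one of them does not vanish under
    the projection ([cross_prefix_full]), so |b_i^*| <= |p| |r|
    ([shortest_proj_le]).  Together M <= |r|^2 |p|, against the choice of M. *)

(** * The inner product and the Euclidean norm *)

Section Dot.
Variables (S : comNzRingType) (n : nat).
Implicit Types u v w : 'cV[S]_n.

Lemma dotC u v : dot u v = dot v u.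
Proof. by apply: eq_bigr => i _; rewrite mulrC. Qed.

Lemma dotDr u v w : dot u (v + w) = dot u v + dot u w.
Proof. by rewrite -big_split; apply: eq_bigr => i _; rewrite mxE mulrDr. Qed.

Lemma dotZr (c : S) u v : dot u (c *: v) = c * dot u v.
Proof. by rewrite mulr_sumr; apply: eq_bigr => i _; rewrite mxE mulrCA. Qed.

Lemma dotBr u v w : dot u (v - w) = dot u v - dot u w.
Proof. by rewrite -[- w]scaleN1r dotDr dotZr mulN1r. Qed.

Lemma dot0r u : dot u 0 = 0.
Proof. by rewrite -(subrr u) dotBr subrr. Qed.

Lemma dotDl u v w : dot (u + v) w = dot u w + dot v w.
Proof. by rewrite ![dot _ w]dotC dotDr. Qed.

Lemma dotZl (c : S) u v : dot (c *: u) v = c * dot u v.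
Proof. by rewrite ![dot _ v]dotC dotZr. Qed.

Lemma dotBl u v w : dot (u - v) w = dot u w - dot v w.
Proof. by rewrite ![dot _ w]dotC dotBr. Qed.

Lemma dot_sumr I (s : seq I) (P : pred I) u (F : I -> 'cV[S]_n) :
  dot u (\sum_(i <- s | P i) F i) = \sum_(i <- s | P i) dot u (F i).
Proof. exact: (big_morph (dot u) (dotDr u) (dot0r u)). Qed.

Lemma dot_delta u (i : 'I_n) : dot u (delta_mx i 0) = u i 0.
Proof.
rewrite /dot (bigD1 i) //= mxE !eqxx mulr1 big1 ?addr0 // => j ji.
by rewrite mxE (negPf ji) mulr0.
Qed.

End Dot.

Lemma mulmx_sum_col (S : comNzRingType) n s (A : 'M[S]_(n, s)) (x : 'cV[S]_s) :
  A *m x = \sum_j x j 0 *: col j A.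
Proof.
apply/colP => i; rewrite mxE summxE.
by apply: eq_bigr => j _; rewrite !mxE mulrC.
Qed.

Lemma dot_mulmx (S : comNzRingType) n s (u : 'cV[S]_n) (A : 'M[S]_(n, s)) x :
  dot u (A *m x) = \sum_j x j 0 * dot u (col j A).
Proof.
rewrite mulmx_sum_col dot_sumr; apply: eq_bigr => j _; exact: dotZr.
Qed.

Lemma dot_mx_of_int (R : realType) n (u v : 'cV[int]_n) :
  dot (mx_of_int R u) (mx_of_int R v) = (dot u v)%:~R.
Proof. by rewrite rmorph_sum; apply: eq_bigr => i _; rewrite !mxE rmorphM. Qed.

Section Norm.
Variables (R : realType) (n : nat).
Implicit Types u v : 'cV[R]_n.

Lemma dot_ge0 u : 0 <= dot u u.
Proof. by apply: sumr_ge0 => i _; rewrite -expr2 sqr_ge0. Qed.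

Lemma enorm_ge0 u : 0 <= enorm u. Proof. exact: sqrtr_ge0. Qed.

Lemma enorm_sqr u : enorm u ^+ 2 = dot u u.
Proof. exact/sqr_sqrtr/dot_ge0. Qed.

Lemma dot_eq0 u : (dot u u == 0) = (u == 0).
Proof.
apply/idP/eqP => [|->]; last by rewrite dot0r.
rewrite psumr_eq0 => [/allP u0|i _]; last by rewrite -expr2 sqr_ge0.
apply/colP => i; rewrite mxE; apply/eqP.
by have := u0 i (mem_index_enum i); rewrite mulf_eq0 orbb.
Qed.

Lemma dot_sqr_le u v : dot u v ^+ 2 <= dot u u * dot v v.
Proof.
have [->|v0] := eqVneq v 0; first by rewrite !dot0r expr0n mulr0.
have vv : 0 < dot v v by rewrite lt_neqAle dot_ge0 eq_sym dot_eq0 v0.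
have := dot_ge0 (dot v v *: u - dot u v *: v).
rewrite !(dotBl, dotBr, dotZl, dotZr) (dotC v u) => h.
have : 0 <= dot v v * (dot u u * dot v v - dot u v ^+ 2) by nra.
by rewrite pmulr_rge0 // subr_ge0.
Qed.

Lemma Cauchy_Schwarz_enorm u v : `|dot u v| <= enorm u * enorm v.
Proof.
rewrite -[leRHS]ger0_norm ?mulr_ge0 ?enorm_ge0 // -ler_sqr ?nnegrE ?normr_ge0 //.
by rewrite !real_normK ?num_real // exprMn !enorm_sqr dot_sqr_le.
Qed.

Lemma enorm_le u v : dot u u <= dot v v -> enorm u <= enorm v.
Proof. exact: ler_wsqrtr. Qed.

End Norm.

(** * Gram-Schmidt vectors and projected lattices *)

Section GramSchmidt.
Variables (R : realType) (n s : nat) (B : 'M[R]_(n, s)).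
Local Notation g := (gram_schmidt B).

(** By induction on i, only the j-th term of the sum subtracted from the i-th
    column meets [g j], and its coefficient is chosen to cancel.  When [g j]
    vanishes, the division by its squared length is harmless, because all inner
    products with it vanish too. *)
Lemma gram_schmidt_lt_orthogonal (i j : 'I_s) : (j < i)%N -> dot (g i) (g j) = 0.
Proof.
have [N] := ubnP i; elim: N i j => [//|N IH] i j /ltnSE iN ji.
rewrite {1}gram_schmidtE dotBl [X in _ - X]dotC dot_sumr (bigD1 j) //=.
rewrite big1 => [|l /andP[li lj]].
  rewrite dotZr addr0 /gs_mu -val_eqE (ltn_eqF ji).
  have [gj0|gj0] := eqVneq (g j) 0; first by rewrite gj0 !dot0r mulr0 subrr.
  by rewrite divfK ?subrr // dot_eq0.
have {}lj : (l : nat) != j := lj.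
rewrite dotZr; case: (ltngtP l j) lj => // lj _.
  by rewrite IH ?mulr0 // (leq_trans ji).
by rewrite dotC IH ?mulr0 // (leq_trans li).
Qed.

Lemma gram_schmidt_orthogonal (i j : 'I_s) : i != j -> dot (g i) (g j) = 0.
Proof.
rewrite -val_eqE /=; case: ltngtP => // ij _; last exact: gram_schmidt_lt_orthogonal.
by rewrite dotC gram_schmidt_lt_orthogonal.
Qed.

Lemma gs_proj_diag i : gs_proj B i i = g i.
Proof.
rewrite /gs_proj (big_pred1 i) => [|j]; first by rewrite /gs_mu eqxx scale1r.
by rewrite /= -[RHS]val_eqE /= eqn_leq andbC.
Qed.

Lemma dot_gram_schmidt0 (u : 'cV[R]_n) (i : 'I_s) :
  (forall j : 'I_s, (j < i)%N -> dot u (col j B) = 0) ->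
  forall j : 'I_s, (j < i)%N -> dot u (g j) = 0.
Proof.
move=> ub j; have [N] := ubnP j; elim: N j => [//|N IH] j /ltnSE jN ji.
rewrite gram_schmidtE dotBr ub // dot_sumr big1 ?subrr // => l lj.
by rewrite dotZr IH ?mulr0 ?(leq_trans lj jN) ?(ltn_trans lj ji).
Qed.

(** The Gram-Schmidt vector differs from the column by a combination of
    earlier columns, which are invisible to u. *)
Lemma dot_gram_schmidt (u : 'cV[R]_n) (i : 'I_s) :
  (forall j : 'I_s, (j < i)%N -> dot u (col j B) = 0) ->
  dot u (g i) = dot u (col i B).
Proof.
move=> ub; rewrite gram_schmidtE dotBr dot_sumr big1 ?subr0 // => l li.
by rewrite dotZr (dot_gram_schmidt0 ub) ?mulr0.
Qed.

(** The row space is the span of the first i Gram-Schmidt vectors, with exactly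
    i rows so that its dimension is visibly at most i. *)
Definition gs_prefix (i : 'I_s) : 'M[R]_(i, n) :=
  \matrix_(j < i) (g (widen_ord (ltnW (ltn_ord i)) j))^T.

(** The part of the j-th column removed by the projection [gs_proj B i j]. *)
Definition gs_low (i j : 'I_s) : 'cV[R]_n :=
  \sum_(l < s | (l <= j)%N && (l < i)%N) gs_mu B j l *: g l.

Lemma col_gs_low_proj (i j : 'I_s) : col j B = gs_low i j + gs_proj B i j.
Proof.
have -> : col j B = \sum_(l < s | (l <= j)%N) gs_mu B j l *: g l.
  rewrite (bigD1 j) //= {1}/gs_mu eqxx scale1r gram_schmidtE.
  rewrite [X in _ + X](eq_bigl (fun l : 'I_s => (l < j)%N)) ?subrK // => l.
  by rewrite ltn_neqAle andbC.
rewrite (bigID (fun l : 'I_s => (l < i)%N)) /=; congr (_ + _).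
by apply: eq_bigl => l; rewrite -leqNgt andbC.
Qed.

Lemma gs_low_prefix i j : ((gs_low i j)^T <= gs_prefix i)%MS.
Proof.
rewrite /gs_low linear_sum; apply: summx_sub => l /andP[_ li].
rewrite linearZ; apply: scalemx_sub.
have := row_sub (Ordinal li) (gs_prefix i); rewrite rowK.
by congr (_ <= _)%MS; congr (_ ^T); congr (g _); apply: val_inj.
Qed.

Lemma dot_gs_low_proj i j l : dot (gs_low i j) (gs_proj B i l) = 0.
Proof.
rewrite /gs_proj dot_sumr big1 // => h /andP[ih _].
rewrite dotC dot_sumr big1 // => h' /andP[_ h'i].
rewrite dotZl dotZr gram_schmidt_orthogonal ?mulr0 //.
by rewrite -val_eqE /= gtn_eqF // (leq_trans h'i).
Qed.

(** The orthogonal projection of v is a vector of the projected lattice, it is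
    nonzero because v is not in the span that is projected out, and projecting
    does not increase the norm. *)
Lemma shortest_proj_le (i : 'I_s) (u v : 'cV[R]_n) (z : 'I_s -> int) :
  shortest_nonzero (gs_lattice B i) u ->
  v = \sum_j (z j)%:~R *: col j B -> ~~ (v^T <= gs_prefix i)%MS ->
  enorm u <= enorm v.
Proof.
move=> [_ _ umin] vE vP.
pose low := \sum_j (z j)%:~R *: gs_low i j.
pose w := \sum_j (z j)%:~R *: gs_proj B i j.
have vlw : v = low + w.
  rewrite vE -big_split; apply: eq_bigr => j _.
  by rewrite /= (col_gs_low_proj i) scalerDr.
have lowP : (low^T <= gs_prefix i)%MS.
  rewrite linear_sum; apply: summx_sub => j _.
  by rewrite linearZ; apply/scalemx_sub/gs_low_prefix.
have w0 : w <> 0 by move=> w0; move: vP; rewrite vlw w0 addr0 lowP.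
have wL : gs_lattice B i w.
  (* The terms of w with j < i vanish, their projections being empty sums. *)
  exists z; rewrite /w (bigID (fun j : 'I_s => (i <= j)%N)) /=.
  rewrite [X in _ + X]big1 ?addr0 // => j; rewrite -ltnNge => ji.
  rewrite /gs_proj big1 ?scaler0 // => l /andP[il lj].
  by have := leq_trans (leq_ltn_trans lj ji) il; rewrite ltnn.
apply: le_trans (umin _ wL w0) _; apply: enorm_le.
have lw : dot low w = 0.
  rewrite dot_sumr big1 // => l _; rewrite dotZr dotC dot_sumr big1 ?mulr0 // => j _.
  by rewrite dotZr dotC dot_gs_low_proj mulr0.
rewrite vlw dotDl !dotDr (dotC w low) lw add0r addr0 lerDr; exact: dot_ge0.
Qed.

End GramSchmidt.

(** * Three-coordinate vectors orthogonal to p and r *)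

Section Cross.
Variables (S : comNzRingType) (n : nat) (p r : 'cV[S]_n).

Definition minor2 (a b : 'I_n) : S := p a 0 * r b 0 - p b 0 * r a 0.

(** On the coordinates a, b, l this is the cross product of the restrictions of
    p and r; it is zero when two of the indices coincide. *)
Definition cross (a b l : 'I_n) : 'cV[S]_n :=
  minor2 a b *: delta_mx l 0 + minor2 b l *: delta_mx a 0
  + minor2 l a *: delta_mx b 0.

Lemma dot_cross_l a b l : dot p (cross a b l) = 0.
Proof. by rewrite !(dotDr, dotZr) !dot_delta /minor2; ring. Qed.

Lemma dot_cross_r a b l : dot r (cross a b l) = 0.
Proof. by rewrite !(dotDr, dotZr) !dot_delta /minor2; ring. Qed.

End Cross.

Lemma map_cross (R : realType) n (p r : 'cV[int]_n) a b l :
  mx_of_int R (cross p r a b l) = cross (mx_of_int R p) (mx_of_int R r) a b l.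
Proof.
by apply/colP => i; rewrite /mx_of_int /cross /minor2 !mxE
  !(rmorphD, rmorphN, rmorphM) /= !rmorph_nat.
Qed.

(** For distinct indices this is Lagrange's identity in dimension three: the
    slack is the square of the inner product of the restrictions of p and r. *)
Lemma dot_cross_le (R : realType) n (p r : 'cV[R]_n) a b l :
  dot (cross p r a b l) (cross p r a b l) <= dot p p * dot r r.
Proof.
have [->|ab] := eqVneq a b.
  have -> : cross p r b b l = 0.
    apply/colP => i; rewrite !mxE /minor2; ring.
  by rewrite dot0r mulr_ge0 ?dot_ge0.
have [->|la] := eqVneq l a.
  have -> : cross p r a b a = 0.
    apply/colP => i; rewrite !mxE /minor2; ring.
  by rewrite dot0r mulr_ge0 ?dot_ge0.
have [->|lb] := eqVneq l b.
  have -> : cross p r a b b = 0.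
    apply/colP => i; rewrite !mxE /minor2; ring.
  by rewrite dot0r mulr_ge0 ?dot_ge0.
have sq3 (u : 'cV[R]_n) :
    u a 0 * u a 0 + u b 0 * u b 0 + u l 0 * u l 0 <= dot u u.
  rewrite /dot (bigD1 a) //= (bigD1 b) 1?eq_sym //= (bigD1 l) ?la ?lb //=.
  rewrite !addrA lerDl; apply: sumr_ge0 => i _; by rewrite -expr2 sqr_ge0.
have pp := sq3 p; have rr := sq3 r.
apply: le_trans (ler_pM _ _ pp rr); try by rewrite !addr_ge0 // -expr2 sqr_ge0.
rewrite {1}/cross !dotDl !dotZl ![dot (delta_mx _ _) _]dotC !dot_delta !mxE !eqxx.
rewrite (negPf la) (negPf lb) (negPf ab) ![b == _]eq_sym (negPf ab) (negPf lb).
rewrite ![a == l]eq_sym (negPf la) /= /minor2 !(mulr0n, mulr1n).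
have := sqr_ge0 (p a 0 * r a 0 + p b 0 * r b 0 + p l 0 * r l 0); nra.
Qed.

(** Modulo the two unit vectors of a and b, the vector of index l is a nonzero
    multiple of the l-th unit vector.  A subspace containing all these vectors
    hence has codimension at most 2. *)
Lemma cross_prefix_full (F : fieldType) n k (p r : 'cV[F]_n) (a b : 'I_n)
    (G : 'M[F]_(k, n)) : minor2 p r a b != 0 ->
  (forall l, ((cross p r a b l)^T <= G)%MS) -> (n <= k + 2)%N.
Proof.
move=> D0 vG; pose E : 'M[F]_(2, n) :=
  \matrix_(i < 2) if i == 0 then delta_mx 0 a else delta_mx 0 b.
have Ea : ((delta_mx a 0 : 'cV[F]_n)^T <= col_mx G E)%MS.
  apply: submx_trans (_ : E <= _)%MS; last by rewrite -addsmxE addsmxSr.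
  by have := row_sub 0 E; rewrite rowK trmx_delta.
have Eb : ((delta_mx b 0 : 'cV[F]_n)^T <= col_mx G E)%MS.
  apply: submx_trans (_ : E <= _)%MS; last by rewrite -addsmxE addsmxSr.
  by have := row_sub 1 E; rewrite rowK trmx_delta.
have full : (1%:M <= col_mx G E)%MS.
  apply/row_subP => l; rewrite row1 -trmx_delta.
  have -> : delta_mx l 0 = (minor2 p r a b)^-1 *: (cross p r a b l
      - minor2 p r b l *: delta_mx a 0 - minor2 p r l a *: delta_mx b 0) :>
      'cV[F]_n.
    rewrite /cross addrAC addrK addrK scalerA mulVf ?scale1r //.
  rewrite linearZ !linearB !linearZ /=; apply: scalemx_sub.
  rewrite !addmx_sub ?scalemx_sub ?eqmx_opp //.
  by apply: submx_trans (vG l) _; rewrite -addsmxE addsmxSl.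
by have := mxrankS full; rewrite mxrank1 => /leq_trans; apply; apply: rank_leq_row.
Qed.

(** An index b with r_b <> 0 whose minors all vanish would give
    p = (p_b / r_b) r. *)
Lemma exists_minor2 (F : fieldType) n (p r : 'cV[F]_n) :
  r != 0 -> (~ exists t, p = t *: r) -> exists a b, minor2 p r a b != 0.
Proof.
move=> r0 pr; have [b rb] : exists b, r b 0 != 0.
  apply/not_existsP => h; case/eqP: r0; apply/colP => i.
  by rewrite mxE; apply/eqP/negPn/negP/h.
apply/not_existsP => h; apply: pr; exists (p b 0 / r b 0); apply/colP => a.
have /forallNP/(_ b)/negP := h a; rewrite negbK subr_eq0 => /eqP prab.
by rewrite mxE mulrAC -prab mulfK.
Qed.

(** * Orthogonality of p to a reduced basis *)

(** For the first column with p b_i <> 0, the identity |r b_i| = M |p b_i|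
    makes the Gram-Schmidt vector longer than |p| |r|, while the projection of
    some [cross] vector is nonzero and at most that long.  The bound i + 1 < m
    is what leaves room for such a vector: the span of i vectors has
    codimension at least 3 in dimension m + 1. *)
Lemma KZ_basis_orthogonal (R : realType) m (p r : 'cV[int]_m.+1) (M : int)
    (V : 'M[int]_(m.+1, m)) :
  0 < M -> (~ exists t : R, mx_of_int R p = t *: mx_of_int R r) ->
  enorm (mx_of_int R r) ^+ 2 * enorm (mx_of_int R p) < M%:~R ->
  null_lattice_basis (M *: p + r) V -> KZ_reduced (mx_of_int R V) ->
  forall i : 'I_m, (i.+1 < m)%N -> dot p (col i V) = 0.
Proof.
move=> M0 pr Mlt [Vker _] [_ Vsh _].
set pR := mx_of_int R p; set rR := mx_of_int R r; set B := mx_of_int R V.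
have colB j : col j B = mx_of_int R (col j V) by apply/colP => i; rewrite !mxE.
have rV j : dot r (col j V) = - (M * dot p (col j V)).
  have /eqP : dot (M *: p + r) (col j V) = 0.
    by apply/Vker; exists (delta_mx j 0); rewrite colE.
  by rewrite dotDl dotZl addrC addr_eq0 => /eqP.
move=> i; have [N] := ubnP i; elim: N i => [//|N IH] i /ltnSE iN im.
have {}IH (j : 'I_m) : (j < i)%N -> dot p (col j V) = 0.
  by move=> ji; apply: IH; rewrite ?(leq_trans ji) // (leq_ltn_trans ji (ltnW im)).
apply/eqP/negPn/negP => pi0.
have rb (j : 'I_m) : (j < i)%N -> dot rR (col j B) = 0.
  by move=> ji; rewrite colB dot_mx_of_int rV IH // mulr0 oppr0.
have far : M%:~R <= enorm rR * enorm (gs_proj B i i).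
  apply: le_trans (Cauchy_Schwarz_enorm _ _).
  rewrite gs_proj_diag dot_gram_schmidt // colB dot_mx_of_int rV.
  rewrite -intr_norm ler_int normrN normrM (ger0_norm (ltW M0)) ler_pMr //.
  by rewrite -gtz0_ge1 normr_gt0.
have r0 : rR != 0.
  apply: contraTneq far => ->.
  by rewrite /enorm dot0r sqrtr0 mul0r -ltNge ltr0z.
have [a [b D0]] := exists_minor2 r0 pr.
have [l lP] : exists l, ~~ ((cross pR rR a b l)^T <= gs_prefix B i)%MS.
  apply/not_existsP => h.
  have /(cross_prefix_full D0) : forall l, ((cross pR rR a b l)^T <= gs_prefix B i)%MS.
    by move=> l; apply/negPn/negP/h.
  by rewrite addn2 ltnS leqNgt im.
have [z zE] : exists z : 'cV[int]_m, cross p r a b l = V *m z.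
  by apply/Vker; rewrite dotDl dotZl dot_cross_l dot_cross_r mulr0 addr0.
have zR : cross pR rR a b l = \sum_j (z j 0)%:~R *: col j B.
  rewrite -map_cross zE /mx_of_int map_mxM mulmx_sum_col.
  by apply: eq_bigr => j _; rewrite mxE.
have near := shortest_proj_le (Vsh i) zR lP.
have crossle : enorm (cross pR rR a b l) <= enorm pR * enorm rR.
  rewrite -sqrtrM ?dot_ge0 //; exact/ler_wsqrtr/dot_cross_le.
move: Mlt; rewrite ltNge => /negP; apply; apply: le_trans far _.
rewrite expr2 -mulrA ler_wpM2l ?enorm_ge0 // mulrC.
exact: le_trans near crossle.
Qed.

(** * The split disjunction *)

Lemma dot_le_nonneg (R : realType) n (u v x : 'cV[R]_n) :
  (forall i, u i 0 <= v i 0) -> (forall i, 0 <= x i 0) -> dot u x <= dot v x.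
Proof. by move=> uv x0; apply: ler_sum => i _; apply: ler_wpM2r. Qed.

Lemma split_of_ratio_bounds (R : realType) n (p a : 'cV[int]_n) (k beta : int)
    (c C : R) : 0 < c -> c <= C ->
  (forall i, c * (p i 0)%:~R <= (a i 0)%:~R <= C * (p i 0)%:~R) ->
  k%:~R * C < beta%:~R < (k + 1)%:~R * c ->
  proven_by_split (KPEQ_relaxation R a beta) p k.
Proof.
move=> c0 cC ac /andP[kb bk].
have bounds (x : 'cV[R]_n) : KPEQ_relaxation R a beta x ->
    c * dot (mx_of_int R p) x <= beta%:~R <= C * dot (mx_of_int R p) x.
  case=> <- x0; rewrite -!dotZl; apply/andP.
  by split; apply: dot_le_nonneg => // i; rewrite !mxE; case/andP: (ac i).
split; rewrite -subset0 => x [/bounds/andP[lo hi]] /=; apply/negP; rewrite -ltNge.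
  rewrite -(ltr_pM2r (lt_le_trans c0 cC)).
  by apply: lt_le_trans kb _; rewrite mulrC.
by rewrite -(ltr_pM2r c0); apply: le_lt_trans bk; rewrite mulrC.
Qed.

(** * Unpruned branch-and-bound nodes *)

(** The values are indexed by depth, so that one sequence describes all the
    fixings along a branch of the tree. *)
Definition prefix_fixing m (s : 'S_m.+1) (v : nat -> nat) (d : nat) :
    node_fixing m.+1 :=
  [ffun i => if (s^-1%g i < d)%N then Some (v (s^-1%g i)) else None].

Lemma prefix_fixingS m (s : 'S_m.+1) v (t : 'I_m.+1) :
  prefix_fixing s v t.+1 = fix_var (prefix_fixing s v t) (s t) (v t).
Proof.
apply/ffunP => i; rewrite !ffunE; have [->|it] := eqVneq i (s t).
  by rewrite permK ltnSn.
have {}it : (s^-1%g i : nat) != t.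
  by apply: contraNneq it => /val_inj <-; rewrite permKV.
by rewrite ltnS leq_eqVlt (negPf it).
Qed.

(** One point x of P agreeing with all the fixed values certifies at once that
    no node on the branch is pruned. *)
Lemma bb_node_prefix (R : realType) m (P : set 'cV[R]_m.+1) (s : 'S_m.+1)
    (v : nat -> nat) (x : 'cV[R]_m.+1) (d : nat) : (d <= m.+1)%N -> P x ->
  (forall t : 'I_m.+1, (t < d)%N -> x (s t) 0 = (v t)%:R) ->
  bb_node P s d (prefix_fixing s v d).
Proof.
move=> + Px; elim: d => [_ _|d IH dm xv].
  have -> : prefix_fixing s v 0 = root_fixing m.+1 by apply/ffunP => i; rewrite !ffunE.
  by apply: bb_root; exists x; split=> // i w; rewrite ffunE.
have -> := prefix_fixingS s v (Ordinal dm); apply: (bb_child (t := Ordinal dm)).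
  by apply: IH => [|t td]; rewrite ?xv ?(ltnW dm) ?leqW.
rewrite -prefix_fixingS; exists x; split=> // i w; rewrite ffunE.
by case: ifP => // id [<-]; rewrite -{1}(permKV s i) xv.
Qed.

(** The variable that comes last in the order takes up what is left of beta. *)
Lemma simplex_slice_nonempty (R : realType) m (a : 'cV[int]_m.+1) (beta : int)
    (s : 'S_m.+1) (v : nat -> nat) :
  (forall i, 0 < a i 0) ->
  \sum_(t < m) a (s (widen_ord (leqnSn m) t)) 0 *+ v t <= beta ->
  exists x, KPEQ_relaxation R a beta x /\
    forall t : 'I_m.+1, (t < m)%N -> x (s t) 0 = (v t)%:R.
Proof.
move=> a0 ab; pose w := widen_ord (leqnSn m).
pose rest : R := (beta - \sum_(t < m) a (s (w t)) 0 *+ v t)%:~R.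
pose x : 'cV[R]_m.+1 := \col_i if (s^-1%g i < m)%N then (v (s^-1%g i))%:R
  else rest / (a (s ord_max) 0)%:~R.
have a0R i : 0 < (a i 0)%:~R :> R by rewrite ltr0z.
exists x; split; last by move=> t tm; rewrite mxE permK tm.
split=> [|i]; last first.
  rewrite mxE; case: ifP => // _; rewrite divr_ge0 ?(ltW (a0R _)) //.
  by rewrite ler0z subr_ge0.
rewrite /dot (reindex_inj (@perm_inj _ s)) big_ord_recr /= !mxE permK ltnn.
rewrite mulrC divfK ?gt_eqF //.
rewrite (eq_bigr (fun t : 'I_m => (a (s (w t)) 0 *+ v t)%:~R)) => [|t _].
  by rewrite /rest rmorphB rmorph_sum /= addrC subrK.
by rewrite !mxE permK /= ltn_ord rmorphMn /= mulr_natr.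
Qed.

(** The nodes of depth m alone suffice: distinct m-tuples with sum at most K
    give distinct fixings, and there are 'C(K + m, m) such tuples. *)
Lemma card_le_bb_nodes (R : realType) m (P : set 'cV[R]_m.+1) (s : 'S_m.+1)
    (K : nat) :
  (forall v : nat -> nat, (\sum_(t < m) v t <= K)%N ->
    exists x, P x /\ forall t : 'I_m.+1, (t < m)%N -> x (s t) 0 = (v t)%:R) ->
  card_le `I_('C(K + m, m)) (bb_nodes P s).
Proof.
move=> ext; rewrite addnC -card_partial_ord_partitions; set T := [set t | _]%SET.
pose v (j : 'I_#|T|) (t : nat) : nat := nth ord0 (enum_val j) t.
pose f j := prefix_fixing s (v j) m.
have f_inj : injective f.
  move=> j j' /ffunP ff; apply: enum_val_inj; apply: eq_from_tnth => t.
  have := ff (s (widen_ord (leqnSn m) t)); rewrite !ffunE permK /= ltn_ord => -[vv].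
  by apply: val_inj; rewrite !(tnth_nth ord0).
have f_node : (range f `<=` bb_nodes P s)%classic.
  move=> _ [j _ <-]; exists m; have := enum_valP j; rewrite inE => sumj.
  have [|x [Px xv]] := ext (v j); last exact: (bb_node_prefix (x := x)).
  rewrite big_tuple in sumj; apply: leq_trans sumj.
  by apply: leq_sum => t _; rewrite (tnth_nth ord0).
apply: card_le_trans (subset_card_le f_node).
rewrite (card_le_eqr (inj_card_eq (in2W f_inj))).
by have := card_eq_le `I_#|T| [set: 'I_#|T|]%classic; rewrite card_II => /esym/andP[].
Qed.

Lemma leq_term_normoo n (p : 'cV[int]_n) i : (`|p i 0%R| <= normoo p)%N.
Proof. exact: (leq_bigmax i). Qed.

(** * Branching on the last variable of the reformulation *)

(** Every point of the reformulation maps to a point of the original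
    relaxation, where px is not an integer; but px is an affine function of
    the last variable alone, with integer coefficients. *)
Lemma last_variable_of_split (R : realType) n s (p a : 'cV[int]_n)
    (V : 'M[int]_(n, s)) (xbeta : 'cV[int]_n) (k : int) :
  (forall j, dot a (col j V) = 0) ->
  (forall i : 'I_s, (i.+1 < s)%N -> dot p (col i V) = 0) ->
  proven_by_split (KPEQ_relaxation R a (dot a xbeta)) p k ->
  proven_by_last_variable (AHL_relaxation R V xbeta).
Proof.
move=> aV pV [below above] lam lamP i iE; apply/negP => /intrP[l lamE].
have colV j : col j (mx_of_int R V) = mx_of_int R (col j V).
  by apply/colP => h; rewrite !mxE.
pose x := mx_of_int R V *m lam + mx_of_int R xbeta.
have xP : KPEQ_relaxation R a (dot a xbeta) x.
  split; last exact: lamP.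
  rewrite dotDr dot_mulmx big1 ?add0r ?dot_mx_of_int // => j _.
  by rewrite colV dot_mx_of_int aV mulr0.
have px : dot (mx_of_int R p) x = (l * dot p (col i V) + dot p xbeta)%:~R.
  rewrite dotDr dot_mulmx (bigD1 i) //= big1 => [|j ji].
    by rewrite addr0 lamE colV !dot_mx_of_int rmorphD rmorphM.
  rewrite colV dot_mx_of_int pV ?mulr0 // ltn_neqAle ltn_ord andbT.
  by apply: contra ji => /eqP js; apply/eqP/val_inj/succn_inj; rewrite js iE.
have [pk|kp] := lerP (l * dot p (col i V) + dot p xbeta) k.
  suff : (set0 : set 'cV[R]_n) x by [].
  by rewrite -below; split=> //=; rewrite px ler_int.
suff : (set0 : set 'cV[R]_n) x by [].
by rewrite -above; split=> //=; rewrite px ler_int lezD1.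
Qed.

(** * Parameters *)

Lemma exists_int_between (R : realType) (x y : R) :
  x + 1 < y -> exists z : int, x < z%:~R < y.
Proof.
move=> xy; exists (Num.floor x + 1); rewrite floorD1_gt /=.
by apply: le_lt_trans xy; rewrite rmorphD /= lerD2r floor_le.
Qed.

(** The coefficients of p are replaced by the largest one. *)
Lemma sum_le_of_normoo n (p : 'cV[int]_n) (k : int) N (f : 'I_N -> 'I_n)
    (v : nat -> nat) : (0 < n)%N -> (forall i, 0 < p i 0) -> 0 <= k ->
  (\sum_(t < N) v t <= `|k|%N %/ normoo p)%N ->
  \sum_(t < N) p (f t) 0 *+ v t <= k.
Proof.
move=> n0 p0 k0 vK; rewrite -(gez0_abs k0).
have nn0 : (0 < normoo p)%N.
  by apply: leq_trans (leq_term_normoo p (Ordinal n0)); rewrite absz_gt0 gt_eqF.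
apply: (@le_trans _ _ ((\sum_(t < N) v t) * normoo p)%N%:Z); last first.
  by rewrite lez_nat -leq_divRL.
rewrite PoszM -[X in _ <= X * _]natz natr_sum mulr_suml; apply: ler_sum => t _.
have := leq_term_normoo p (f t); rewrite -lez_nat gtz0_abs //.
by rewrite mulr_natl lerMn2r => ->; rewrite orbT.
Qed.

(* The dimension n is m.+1, so n - 1 is m. *)
Theorem theorem2 (R : realType) (m : nat) (p r : 'cV[int]_m.+1) (k M : int)
    (p_pos : forall i : 'I_m.+1, 0 < p i 0)
    (p_r : ~ exists t : R, mx_of_int R p = t *: mx_of_int R r) :
  let q := fun i : 'I_m.+1 => (r i 0)%:~R / (p i 0)%:~R : R in
  let q1 := q ord0 in
  let qn := q ord_max in
  (forall i j : 'I_m.+1, (i <= j)%N -> q i <= q j) ->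
  0 <= k ->
  Num.max (k%:~R * qn - k%:~R * q1 - q1 + 1)
          (2 * Num.sqrt m.+1%:R
             * enorm (mx_of_int R r) ^+ 2 * enorm (mx_of_int R p) ^+ 2) < M%:~R ->
  let a : 'cV[int]_m.+1 := M *: p + r in
  let in_range := fun beta : int =>
    k%:~R * (M%:~R + qn) < beta%:~R < (k + 1)%:~R * (M%:~R + q1) in
  (exists beta : int, in_range beta) /\
  (forall beta : int, in_range beta ->
   [/\ proven_by_split (KPEQ_relaxation R a beta) p k,
       forall s : 'S_m.+1,
         card_le `I_('C(`|k|%N %/ normoo p + m, m))
                 (bb_nodes (KPEQ_relaxation R a beta) s) &
       forall (V : 'M[int]_(m.+1, m)) (xbeta : 'cV[int]_m.+1),
         null_lattice_basis a V -> KZ_reduced (mx_of_int R V) ->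
         dot a xbeta = beta ->
         proven_by_last_variable (AHL_relaxation R V xbeta)]).
Proof.
move=> q q1 qn q_mono k0; rewrite gt_max => /andP[Mk Mbig] a in_range.
have kR : 0 <= k%:~R :> R by rewrite ler0z.
have q1n : q1 <= qn by exact: q_mono.
have q1M : 0 < M%:~R + q1 by nra.
have pR i : 0 < (p i 0)%:~R :> R by rewrite ltr0z.
have rE i : (r i 0)%:~R = q i * (p i 0)%:~R by rewrite divfK ?gt_eqF.
have a_ratio i : (M%:~R + q1) * (p i 0)%:~R <= (a i 0)%:~R
    <= (M%:~R + qn) * (p i 0)%:~R.
  have := q_mono ord0 i (leq0n _); have := q_mono i ord_max (leq_ord _).
  rewrite !mxE rmorphD rmorphM /= rE -mulrDl => qi1 qin.
  by rewrite !ler_pM2r ?lerD2l ?qi1 ?qin.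
have a_pos i : 0 < a i 0.
  rewrite -(ltr0z R); case/andP: (a_ratio i) => + _; apply: lt_le_trans.
  exact: mulr_gt0.
(* The norm of the positive integral vector p and the factor 2 sqrt n are at least 1. *)
have Mnorm : enorm (mx_of_int R r) ^+ 2 * enorm (mx_of_int R p) < M%:~R.
  apply: le_lt_trans Mbig.
  have p1 : 1 <= enorm (mx_of_int R p).
    rewrite -sqrtr1; apply: ler_wsqrtr; rewrite dot_mx_of_int ler1z.
    rewrite /dot big_ord_recl -gtz0_ge1 ltr_pwDl ?mulr_gt0 //.
    by apply: sumr_ge0 => i _; rewrite -expr2 sqr_ge0.
  have n1 : 1 <= Num.sqrt m.+1%:R :> R by rewrite -{1}sqrtr1 ler_wsqrtr ?ler1n.
  move: (enorm _ ^+ 2) (sqr_ge0 (enorm (mx_of_int R r))) => A A0.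
  have AP : A * enorm (mx_of_int R p) <= A * enorm (mx_of_int R p) ^+ 2.
    by rewrite ler_wpM2l // expr2 ler_peMl ?enorm_ge0.
  apply: le_trans AP _; rewrite -[leRHS]mulrA ler_peMl ?mulr_ge0 ?enorm_ge0 //.
  nra.
have M0 : 0 < M.
  rewrite -(ltr0z R); apply: le_lt_trans Mnorm.
  by rewrite mulr_ge0 ?sqr_ge0 ?enorm_ge0.
split.
  by apply: exists_int_between; rewrite rmorphD rmorph1; lra.
move=> beta bP; have split_k : proven_by_split (KPEQ_relaxation R a beta) p k.
  by apply: split_of_ratio_bounds a_ratio bP; rewrite ?lerD2l.
split=> // [s | V xbeta Vbasis Vkz xbetaE].
  apply: card_le_bb_nodes => v vK; apply: simplex_slice_nonempty => //.
  rewrite -(ler_int R); apply: le_trans (ltW (andP bP).1).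
  rewrite rmorph_sum /=.
  have pv : (\sum_(t < m) p (s (widen_ord (leqnSn m) t)) 0 *+ v t)%:~R <= k%:~R :> R.
    by rewrite ler_int; apply: sum_le_of_normoo.
  apply: le_trans (ler_wpM2r (ltW (lt_le_trans q1M _)) pv); last by rewrite lerD2l.
  rewrite rmorph_sum mulr_suml; apply: ler_sum => t _.
  rewrite !rmorphMn /= mulrnAl lerMn2r mulrC.
  by case/andP: (a_ratio (s (widen_ord (leqnSn m) t))) => _ ->; rewrite orbT.
apply: (last_variable_of_split (p := p) (a := a) (k := k)).
- by move=> j; apply/Vbasis.1; exists (delta_mx j 0); rewrite colE.
- exact: KZ_basis_orthogonal Vbasis Vkz.
- by rewrite xbetaE.
Qed.
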